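(* Let $S\subset\mathbb{R}^2$ be a Lebesgue measurable set of infinite Lebesgue measure. Then $S$ contains the four vertices of an isosceles trapezoid of area $1$.
   Context: Lebesgue measure on $\mathbb{R}^2$ is the two-dimensional Lebesgue measure, and $\mathbb{R}^2$ carries the Euclidean metric. An isosceles trapezoid is a (non-degenerate, convex) quadrilateral obtained from an isosceles triangle by cutting off its apex along a line parallel to its base; that is, its four vertices are the two base vertices of the isosceles triangle together with the two points where a line parallel to the base, strictly between the base and the apex, meets the two equal sides. The area is that of the quadrilateral. *)

(* Defs.v *)
From mathcomp Require Import all_boot all_order all_algebra.
From mathcomp Require Import all_classical all_reals all_analysis.

Set Implicit Arguments.
Unset Strict Implicit.
Unset Printing Implicit Defensive.

Import Order.TTheory GRing.Theory Num.Theory.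
Import numFieldNormedType.Exports.

Local Open Scope classical_set_scope.
Local Open Scope ring_scope.

(* [lebesgue_measure \x lebesgue_measure] is a measure on the Borel sets of the
   plane only. Its completion is the two-dimensional Lebesgue measure: it is the
   induced outer measure, and its Caratheodory-measurable sets are the Lebesgue
   measurable subsets of the plane. *)
Definition lebesgue_measure2 (R : realType) : set (R * R) -> \bar R :=
  @completed_measure_extension _ _ R (@lebesgue_measure R \x @lebesgue_measure R)%E.

Definition lebesgue_measurable2 (R : realType) (S : set (R * R)) : Prop :=
  (@lebesgue_measure2 R).-caratheodory S.

(* The canonical norm on [R * R] is the sup norm, hence this definition. *)
Definition euclidean_dist (R : realType) (p q : R * R) : R :=
  Num.sqrt ((p.1 - q.1) ^+ 2 + (p.2 - q.2) ^+ 2).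

Definition parallel (R : realType) (u v : R * R) : Prop :=
  u.1 * v.2 = u.2 * v.1.

Definition strictly_between (R : realType) (p q x : R * R) : Prop :=
  exists2 t : R, 0 < t < 1 &
    x = ((1 - t) * p.1 + t * q.1, (1 - t) * p.2 + t * q.2).

Definition isosceles_triangle (R : realType) (a b c : R * R) : Prop :=
  ~ parallel (b - a) (c - a) /\ euclidean_dist c a = euclidean_dist c b.

(* [a], [b], [d], [e] are the vertices in cyclic order: [c] is the apex of the
   triangle with base [a b], and the line [d e], parallel to the base, cuts the
   side [b c] at [d] and the side [a c] at [e]. *)
Definition isosceles_trapezoid (R : realType) (a b d e : R * R) : Prop :=
  exists c : R * R,
    [/\ isosceles_triangle a b c,
        strictly_between b c d,
        strictly_between a c e
      & parallel (d - e) (b - a)].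

(* [R^o] is [R] seen as a module over itself. *)
Definition convex_hull (R : realType) (V : set (R * R)) : set (R * R) :=
  smallest (@convex_set R (R^o * R^o)%type) V.

(* The region bounded by a convex quadrilateral is the convex hull of its
   vertices. *)
Definition convex_quadrilateral_area (R : realType) (a b d e : R * R) : \bar R :=
  lebesgue_measure2 (convex_hull [set a; b; d; e]).

(* Main.v *)
Require Import Defs.
From mathcomp Require Import all_boot all_order all_algebra.
From mathcomp Require Import all_classical all_reals all_analysis.
From mathcomp Require Import measurable_realfun.
From mathcomp Require Import ring lra.

(** As [S] has infinite measure and squares have finite area, [S] has positive
    measure in some bounded region and again outside every square. The trapezoid
    found has its long base in the bounded region and its short base, tiny, very
    far from there.

    Let [q] be a point, [x] another one and [X = x - q]. Turn [X / |X|^2] by a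
    quarter turn to get [v] ([turned_inversion]). The triangle with apex [q]
    and base vertices [x + v] and [x - v] is isosceles of area
    [|X| * |v| = 1]. Shortening the base by [w] at both ends and opening the
    apex into a segment with half-length [w] gives an isosceles trapezoid with
    the same height and the same mean of the bases, so again with area [1].
    For small [w] its vertices are as close as desired to [x + v], [x - v] and
    twice [q].

    Suppose that, for some small [d], the set [S] fills most of the boxes of
    radius [2 * d] around [q], [x + v] and [x - v]. The four sets of those
    translations, of size at most [d], that bring a given vertex of the
    trapezoid out of [S] are too small to cover all translations of that size,
    so some translate has its four vertices in [S] ([exists_unit_trapezoid]).

    Such [q], [x] and [d] exist. Take first a box of radius [2 * r] almost
    filled by [S]. Next, far away compared to [1 / r], take [q] such that a box
    around [q] of a much smaller radius [2 * d] is almost filled by [S]. If [x]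
    moves in the first box, then [v] is short, and [X |-> X / |X|^2] is a
    contraction far from [0], so that [x |-> x + v] and [x |-> x - v] expand
    distances by at least a half. Hence if [x] runs through a grid of mesh
    [8 * d], the boxes of radius [2 * d] around [x + v] are disjoint, as are
    those around [x - v]; as [S] misses a tiny part of the large box only, it
    fills most of both small boxes for some [x] ([exists_dense_base]).

    The almost filled boxes come from a weak form of the density theorem
    ([exists_dense_box]), obtained by applying Fubini's theorem and, twice, the
    definition of the measure of a subset of the line by covers
    ([exists_dense_interval]). The area of the trapezoid, as the measure of a
    convex hull, is a Fubini computation in a frame adapted to its axis; the
    change of frame preserves areas because a rotation is a product of
    shears. *)

Set Implicit Arguments.
Unset Strict Implicit.
Unset Printing Implicit Defensive.

Import Order.TTheory GRing.Theory Num.Theory.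
Import numFieldNormedType.Exports.

Local Open Scope classical_set_scope.
Local Open Scope ring_scope.

Local Notation plane R := (measurableTypeR R * measurableTypeR R)%type.
Local Notation length := lebesgue_measure.
Local Notation area := (lebesgue_measure \x lebesgue_measure)%E.

(** * Area-preserving maps *)

Section area_preserving.
Context {R : realType}.
Implicit Types (f g : plane R -> plane R) (B : set (plane R)).

Lemma length_translate (t : R) (B : set (measurableTypeR R)) : measurable B ->
  length ((fun x : R => x + t) @^-1` B) = length B.
Proof.
have mt : measurable_fun [set: measurableTypeR R]
    (fun x : measurableTypeR R => (x + t : measurableTypeR R)).
  exact: measurable_funD.
move=> mB.
apply/esym; apply: (@lebesgue_measure_unique R (pushforward length
  (fun x : measurableTypeR R => (x + t : measurableTypeR R)))) => //.
move=> _ [[a b]] _ <-; rewrite /pushforward.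
have E : (fun x : R => x + t) @^-1` [set` `]a, b]] = [set` `]a - t, b - t]].
  by apply/seteqP; split => x /=; rewrite !in_itv/= ltrBlDr lerBrDr.
rewrite [RHS](congr1 length E) !lebesgue_measure_itv/= !lte_fin ltrD2r.
by case: ifP => // _; rewrite -!EFinB; congr EFin; ring.
Qed.

Definition area_preserving f := measurable_fun setT f /\
  forall B, measurable B -> area (f @^-1` B) = area B.

Lemma area_preserving_comp f g :
  area_preserving f -> area_preserving g -> area_preserving (f \o g).
Proof.
move=> [mf af] [mg ag]; split; first exact: measurableT_comp.
by move=> B mB; rewrite comp_preimage ag ?af// -[X in measurable X]setTI; exact: mf.
Qed.

Lemma area_preserving_id : area_preserving id.
Proof. by split. Qed.

Lemma area_preserving_swap : area_preserving (fun p => (p.2, p.1)).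
Proof.
have ms : measurable_fun setT (fun p : plane R => (p.2, p.1)).
  exact: measurable_swap.
split => // B mB; apply/esym.
apply: (@product_measure_unique _ _ _ _ R length length
  (pushforward area (fun p : plane R => (p.2, p.1)))) => //.
move=> X Y mX mY; rewrite /pushforward.
have E : (fun p : plane R => (p.2, p.1)) @^-1` (X `*` Y) = Y `*` X.
  by apply/seteqP; split => p /= [].
by rewrite [LHS](congr1 area E) product_measure1E// muleC.
Qed.

Lemma area_preserving_shear (h : measurableTypeR R -> measurableTypeR R) :
  measurable_fun setT h -> area_preserving (fun p => (p.1, p.2 + h p.1)).
Proof.
move=> mh.
have ms : measurable_fun setT (fun p : plane R => (p.1, p.2 + h p.1) : plane R).
  apply/measurable_fun_pair; first exact: measurable_fst.
  by apply: measurable_funD; [exact: measurable_snd|exact: (measurableT_comp mh measurable_fst)].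
split => // B mB; rewrite /product_measure1; apply: eq_integral => x _ /=.
rewrite -[RHS](length_translate (h x)); last exact: measurable_xsection.
by congr length; apply/seteqP; split => y; rewrite /xsection/= !inE.
Qed.

Lemma area_preserving_translate (t : plane R) :
  area_preserving (fun p => (p.1 + t.1, p.2 + t.2)).
Proof.
have s (u : R) := @area_preserving_shear (fun=> u) (measurable_cst u).
have w := area_preserving_swap.
exact: (area_preserving_comp w (area_preserving_comp (s t.1)
  (area_preserving_comp w (s t.2)))).
Qed.

(** A rotation other than the half-turn is a product of three shears, and the
    half-turn is the square of a quarter turn. *)
Lemma area_preserving_rotation (c s : R) : c ^+ 2 + s ^+ 2 = 1 ->
  area_preserving (fun p => (c * p.1 - s * p.2, s * p.1 + c * p.2)).
Proof.
have sh (k : R) : area_preserving (fun p => (p.1, p.2 + k * p.1)).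
  by apply: (@area_preserving_shear (fun x => k * x)); exact: measurable_funM.
have w := area_preserving_swap.
have main (c' s' : R) : c' ^+ 2 + s' ^+ 2 = 1 -> s' != 0 ->
    area_preserving (fun p => (c' * p.1 - s' * p.2, s' * p.1 + c' * p.2)).
  move=> cs s0; pose k := (c' - 1) / s'.
  have := area_preserving_comp w (area_preserving_comp (sh k)
    (area_preserving_comp w (area_preserving_comp (sh s')
    (area_preserving_comp w (area_preserving_comp (sh k) w))))).
  congr area_preserving; apply/funext => -[x y] /=; rewrite /k.
  have cs' : c' * c' = 1 - s' * s' by rewrite -cs; ring.
  congr pair.
    by apply: (mulfI s0); field: cs'.
  by field: cs'.
move=> cs; have [s0|] := eqVneq s 0; last exact: main.
move: cs; rewrite s0 expr0n addr0 => /eqP; rewrite sqrf_eq1 => /orP[]/eqP->.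
  have := area_preserving_id; congr area_preserving.
  by apply/funext => -[x y]/=; congr pair; ring.
have q := main 0 1 _ (oner_neq0 R).
have := area_preserving_comp (q _) (q _); rewrite expr0n/= add0r expr1n.
move=> /(_ erefl erefl); congr area_preserving.
by apply/funext => -[x y]/=; congr pair; ring.
Qed.

End area_preserving.

(** * The area of a trapezoid *)

Section trapezoid_area.
Context {R : realType}.

Lemma measurable_ler (f g : plane R -> measurableTypeR R) :
  measurable_fun setT f -> measurable_fun setT g ->
  measurable [set p | f p <= g p].
Proof.
move=> mf mg; have mgf : measurable_fun setT (fun p => g p - f p).
  exact: measurable_funB.
have := mgf measurableT _ (measurable_itv `[0, +oo[); rewrite setTI.
congr measurable; apply/seteqP; split => p /=; rewrite in_itv/= andbT subr_ge0//.
Qed.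

(** The region between two bases that are perpendicular to the first axis,
    with half-lengths [V] at abscissa [0] and [w] at abscissa [h]. *)
Definition upright_trapezoid (h V w : R) : set (plane R) :=
  [set p | [/\ 0 <= p.1, p.1 <= h & `|p.2| <= V + (w - V) / h * p.1]].

Lemma measurable_upright_trapezoid h V w : measurable (upright_trapezoid h V w).
Proof.
have m1 : measurable_fun setT (fun p : plane R => p.1) by exact: measurable_fst.
have m2 : measurable_fun setT (fun p : plane R => p.2) by exact: measurable_snd.
have mc (c : measurableTypeR R) : measurable_fun setT (fun _ : plane R => c).
  exact: measurable_cst.
have ml : measurable_fun setT
    (fun p : plane R => V + (w - V) / h * p.1 : measurableTypeR R).
  by apply: measurable_funD => //; apply: measurable_funM.
have -> : upright_trapezoid h V w = [set p | 0 <= p.1] `&`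
    ([set p | p.1 <= h] `&` [set p | `|p.2| <= V + (w - V) / h * p.1]).
  by apply/seteqP; split => p /=; [move=> []|move=> [? []]].
apply: measurableI; first exact: measurable_ler.
apply: measurableI; first exact: measurable_ler.
apply: measurable_ler => //.
exact: (measurableT_comp (@normr_measurable R setT) m2).
Qed.

Lemma area_upright_trapezoid (h V w : R) : 0 < h -> 0 < w -> 0 < V ->
  area (upright_trapezoid h V w) = ((V + w) * h)%:E.
Proof.
move=> h0 w0 V0; pose k := (w - V) / h.
have kh : k * h = w - V by rewrite /k mulfVK// gt_eqF.
have l0 (x : R) : 0 <= x -> x <= h -> 0 <= V + k * x.
  move=> x0 xh; have : 0 <= V * (h - x) + w * x.
    by rewrite addr_ge0// mulr_ge0 ?subr_ge0// ltW.
  rewrite (_ : _ + _ = (V + k * x) * h); first by rewrite pmulr_lge0.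
  by rewrite mulrDl mulrAC kh; ring.
transitivity (\int[length]_(x in `[0%R, h]) ((2 * (V + k * x))%:E))%E.
  rewrite /product_measure1 [RHS]integral_mkcond; apply: eq_integral => x _ /=.
  rewrite patchE mem_setE in_itv/=; case: ifPn.
    move=> /andP[x0 xh].
    have E : xsection (upright_trapezoid h V w) x =
        [set` `[- (V + k * x), V + k * x]].
      apply/seteqP; split => y; rewrite /xsection/= inE/= in_itv/=.
        by case=> _ _; rewrite ler_norml.
      by move=> yl; split => //=; rewrite ler_norml.
    rewrite E lebesgue_measure_itv/= lte_fin.
    case: ifPn => [_|]; first by rewrite -EFinB; congr EFin; ring.
    rewrite -leNgt => le; congr EFin.
    have := l0 _ x0 xh; lra.
  move=> nx.
  have -> : xsection (upright_trapezoid h V w) x = set0.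
    apply/seteqP; split => y //; rewrite /xsection/= inE/= => -[/= x0 xh _].
    by rewrite x0 xh in nx.
  by rewrite measure0.
(* [F] is a primitive of the length of the section at [x]. *)
pose F x := 2 * V * x + k * x ^+ 2.
rewrite (@continuous_FTC2 _ _ F)//.
- rewrite -EFinB; congr EFin; rewrite /F expr2 mulrA kh; ring.
- apply: continuous_subspaceT => x; apply: cvgM; first exact: cvg_cst.
  apply: cvgD; first exact: cvg_cst.
  by apply: cvgM; [exact: cvg_cst|exact: cvg_id].
- have dF (x : R) : derivable F x 1 by rewrite /F; apply: derivableD => //.
  have cF (x : R) : {for x, continuous F}.
    by apply: differentiable_continuous; apply/derivable1_diffP.
  split => //.
  by apply: cvg_at_right_filter; exact: cF.
  by apply: cvg_at_left_filter; exact: cF.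
- move=> x _; rewrite derive1E /F.
  rewrite deriveD//.
  have -> : 'D_1 (fun x0 : R => 2 * V * x0) x = 2 * V.
    by rewrite deriveM// derive_cst derive_id; rewrite /GRing.scale/=; ring.
  rewrite deriveM// derive_cst exp_derive.
  rewrite /GRing.scale/= expr1; ring.
Qed.

End trapezoid_area.

Section trapezoid_hull.
Context {R : realType}.

Lemma lebesgue_measure2E (B : set (plane R)) :
  measurable B -> lebesgue_measure2 B = area B.
Proof. exact: measurable_mu_extE. Qed.

Lemma convex_hull_segment (V : set (R * R)) (p q : R * R) (t : R) :
  0 <= t -> t <= 1 -> convex_hull V p -> convex_hull V q ->
  convex_hull V (t * p.1 + (1 - t) * q.1, t * p.2 + (1 - t) * q.2).
Proof.
move=> t0 t1 Vp Vq C [cC VC].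
have Cp : C p by apply: Vp.
have Cq : C q by apply: Vq.
by have := cC p q (Itv01 t0 t1) (mem_set Cp) (mem_set Cq); rewrite inE.
Qed.

Lemma convex_hullS (V : set (R * R)) : V `<=` convex_hull V.
Proof. by move=> p Vp C [_]; apply. Qed.

(** The coordinates of a point in the orthonormal frame with origin [c] and
    first vector the unit vector [u]. *)
Definition to_frame (c u p : R * R) : R * R :=
  (u.1 * (p.1 - c.1) + u.2 * (p.2 - c.2),
   - u.2 * (p.1 - c.1) + u.1 * (p.2 - c.2)).

Definition of_frame (c u p : R * R) : R * R :=
  (c.1 + u.1 * p.1 - u.2 * p.2, c.2 + u.2 * p.1 + u.1 * p.2).

Lemma of_frameK (c u : R * R) : u.1 ^+ 2 + u.2 ^+ 2 = 1 ->
  cancel (of_frame c u) (to_frame c u).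
Proof.
case: u => u v /= uv [x y]; rewrite /to_frame /of_frame/=.
congr pair.
  by transitivity ((u ^+ 2 + v ^+ 2) * x); [ring|rewrite uv mul1r].
by transitivity ((u ^+ 2 + v ^+ 2) * y); [ring|rewrite uv mul1r].
Qed.

Lemma to_frameK (c u : R * R) : u.1 ^+ 2 + u.2 ^+ 2 = 1 ->
  cancel (to_frame c u) (of_frame c u).
Proof.
case: u => u v /= uv [x y]; rewrite /to_frame /of_frame/=; congr pair.
  transitivity (c.1 + (u ^+ 2 + v ^+ 2) * (x - c.1)); first by ring.
  by rewrite uv; ring.
transitivity (c.2 + (u ^+ 2 + v ^+ 2) * (y - c.2)); first by ring.
by rewrite uv; ring.
Qed.

Lemma area_preserving_to_frame (c u : R * R) : u.1 ^+ 2 + u.2 ^+ 2 = 1 ->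
  area_preserving (to_frame c u : plane R -> plane R).
Proof.
move=> uv; have uv' : u.1 ^+ 2 + (- u.2) ^+ 2 = 1 by rewrite sqrrN.
have := area_preserving_comp (area_preserving_rotation uv')
  (area_preserving_translate (- c.1, - c.2)).
by congr area_preserving; apply/funext => p; rewrite /to_frame/= mulNr opprK.
Qed.

Lemma upright_trapezoid_convex (h V w t : R) (p q : R * R) :
  0 <= t -> t <= 1 ->
  upright_trapezoid h V w p -> upright_trapezoid h V w q ->
  upright_trapezoid h V w
    (t * p.1 + (1 - t) * q.1, t * p.2 + (1 - t) * q.2).
Proof.
case: p q => p1 p2 [q1 q2] t0 t1.
rewrite /upright_trapezoid/= => -[p0 ph]; rewrite ler_norml => /andP[pl pu].
move=> [q0 qh]; rewrite ler_norml => /andP[ql qu].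
have t'0 : 0 <= 1 - t by rewrite subr_ge0.
have cc x y x' y' : x <= x' -> y <= y' ->
    t * x + (1 - t) * y <= t * x' + (1 - t) * y'.
  by move=> xx yy; rewrite lerD// ler_wpM2l.
split.
- by rewrite addr_ge0// mulr_ge0.
- by apply: le_trans (cc _ _ _ _ ph qh) _; lra.
- rewrite ler_norml; apply/andP; split.
    apply: le_trans (cc _ _ _ _ pl ql); set k := (w - V) / h; lra.
  apply: le_trans (cc _ _ _ _ pu qu) _; set k := (w - V) / h; lra.
Qed.

Lemma convex_hull_trapezoid (c u : R * R) (h V w : R) :
  u.1 ^+ 2 + u.2 ^+ 2 = 1 -> 0 < h -> 0 < w -> 0 < V ->
  convex_hull [set of_frame c u (0, - V); of_frame c u (0, V);
                   of_frame c u (h, w); of_frame c u (h, - w)] =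
  to_frame c u @^-1` upright_trapezoid h V w.
Proof.
move=> u1 h0 w0 V0; have kh : (w - V) / h * h = w - V by rewrite mulfVK// gt_eqF.
apply/seteqP; split => [p|p].
  apply; split.
    move=> x y l; rewrite !inE/= => Tx Ty.
    have l0 : 0 <= l%:num by [].
    have l1 : l%:num <= 1 by [].
    have := upright_trapezoid_convex l0 l1 Tx Ty.
    suff -> : to_frame c u (conv l x y) =
      (l%:num * (to_frame c u x).1 + (1 - l%:num) * (to_frame c u y).1,
       l%:num * (to_frame c u x).2 + (1 - l%:num) * (to_frame c u y).2) by [].
    have -> : (conv l x y) = (l%:num * x.1 + (1 - l%:num) * y.1,
       l%:num * x.2 + (1 - l%:num) * y.2) by [].
    by rewrite /to_frame/=; congr pair; ring.
  move=> _ /= [[[]|]|] ->; rewrite of_frameK// /upright_trapezoid/=.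
  - by rewrite mulr0 addr0 normrN lexx ltW// ger0_norm// ltW.
  - by rewrite mulr0 addr0 lexx ltW// ger0_norm// ltW.
  - by rewrite kh addrC subrK lexx ltW// ger0_norm// ltW.
  - by rewrite kh addrC subrK normrN lexx ltW// ger0_norm// ltW.
move=> /=; rewrite -[in X in _ -> X](to_frameK c u1 p).
case: (to_frame c u p) => x y [/= x0 xh]; rewrite ler_norml => /andP[yl yu].
(* The point with coordinates [(x, y)] lies on the section at abscissa [x],
   whose endpoints lie on the legs. *)
set H := convex_hull _.
have aH : H (of_frame c u (0, - V)) by apply: convex_hullS; left; left; left.
have bH : H (of_frame c u (0, V)) by apply: convex_hullS; left; left; right.
have dH : H (of_frame c u (h, w)) by apply: convex_hullS; left; right.
have eH : H (of_frame c u (h, - w)) by apply: convex_hullS; right.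
set l := V + (w - V) / h * x in yl yu.
pose t := x / h.
have t0 : 0 <= t by rewrite divr_ge0// ltW.
have t1 : t <= 1 by rewrite ler_pdivrMr// mul1r.
have xE : x = t * h by rewrite mulfVK// gt_eqF.
have lE : l = (1 - t) * V + t * w by rewrite /l /t; ring.
have l0 : 0 < l.
  have [t0'|t0'] := eqVneq t 0; first by rewrite lE t0' mul0r addr0 subr0 mul1r.
  rewrite lE ltr_wpDl// ?mulr_ge0 ?subr_ge0// ?(ltW V0)//.
  by rewrite mulr_gt0// lt0r t0'.
have leH : H (of_frame c u (x, - l)).
  have := convex_hull_segment t0 t1 eH aH; congr (H _).
  by rewrite /of_frame/= lE xE; congr pair; ring.
have luH : H (of_frame c u (x, l)).
  have := convex_hull_segment t0 t1 dH bH; congr (H _).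
  by rewrite /of_frame/= lE xE; congr pair; ring.
have s0 : 0 <= (l - y) / (2 * l) by rewrite divr_ge0 ?mulr_ge0// ?subr_ge0// ltW.
have s1 : (l - y) / (2 * l) <= 1.
  by rewrite ler_pdivrMr ?mulr_gt0//; lra.
have := convex_hull_segment s0 s1 leH luH; congr (H _).
by rewrite /of_frame/=; congr pair; field; rewrite gt_eqF.
Qed.

Lemma trapezoid_area (c u : R * R) (h V w : R) :
  u.1 ^+ 2 + u.2 ^+ 2 = 1 -> 0 < h -> 0 < w -> 0 < V ->
  convex_quadrilateral_area (of_frame c u (0, - V)) (of_frame c u (0, V))
    (of_frame c u (h, w)) (of_frame c u (h, - w)) = ((V + w) * h)%:E.
Proof.
move=> u1 h0 w0 V0; have [mf af] := area_preserving_to_frame c u1.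
have mT := measurable_upright_trapezoid h V w.
rewrite /convex_quadrilateral_area convex_hull_trapezoid// lebesgue_measure2E.
  by rewrite af// area_upright_trapezoid.
by rewrite -[X in measurable X]setTI; exact: mf.
Qed.

End trapezoid_hull.

(** * Borel subsets of Lebesgue measurable sets *)

Section inner_borel_sets.
Context {R : realType}.

Definition square (k : R) : set (plane R) :=
  [set` `[- k, k]] `*` [set` `[- k, k]].

Lemma area_setX (X Y : set (measurableTypeR R)) : measurable X -> measurable Y ->
  area (X `*` Y) = (length X * length Y)%E.
Proof. exact: product_measure1E. Qed.

Lemma measurable_square k : measurable (square k).
Proof. exact: measurableX. Qed.

Lemma area_square_lty k : (area (square k) < +oo)%E.
Proof.
rewrite area_setX// !lebesgue_measure_itv/=.
by case: ifPn => _; rewrite ?mule0// -?EFinB -?EFinM ltry.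
Qed.

(** The outer measure of [Q `\` U] is less than the area of [Q], so some Borel
    cover of [Q `\` U] is smaller than [Q]; what it leaves of [Q] lies in [U]. *)
Lemma inner_borel_subset (U Q : set (plane R)) :
  lebesgue_measurable2 U -> (0 < lebesgue_measure2 U)%E ->
  measurable Q -> (area Q < +oo)%E -> U `<=` Q ->
  exists A, [/\ measurable A, A `<=` U & (0 < area A)%E].
Proof.
move=> mU U0 mQ Qoo UQ.
have QE := mU Q.
rewrite lebesgue_measure2E// in QE.
rewrite (setIidr UQ) in QE.
have : (lebesgue_measure2 (Q `&` ~` U) < area Q)%E.
  have Qf : area Q \is a fin_num by rewrite ge0_fin_numE.
  have U'0 : (0 <= lebesgue_measure2 (Q `&` ~` U))%E by exact: outer_measure_ge0.
  rewrite QE lteDr// ge0_fin_numE//; apply: le_lt_trans Qoo.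
  by rewrite QE leeDr// ltW.
move=> /ereal_inf_lt[_ [F [mF QF] <-] FQ].
have mC : measurable (\bigcup_i F i) by exact: bigcupT_measurable.
have CQ : (area (\bigcup_i F i) < area Q)%E.
  by apply: le_lt_trans FQ; exact: measure_sigma_subadditive.
exists (Q `\` \bigcup_i F i); split; first exact: measurableD.
  by move=> p [Qp nFp]; apply: contrapT => nUp; apply: nFp; exact: QF.
rewrite ltNge; apply/negP => A0.
have : (area Q <= area (\bigcup_i F i))%E.
  rewrite (measureDI _ mQ mC) -[leRHS]add0e.
  by apply: leeD; [exact: A0|exact: measureIr].
by rewrite leNgt CQ.
Qed.

(** A square has finite area, so the part of [S] outside [square m] still has
    infinite measure, and a bounded piece of it has positive measure. *)
Lemma far_borel_subset (S : set (plane R)) (m : R) :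
  lebesgue_measurable2 S -> lebesgue_measure2 S = +oo%E ->
  exists A, [/\ measurable A, A `<=` S `\` square m, (0 < area A)%E &
    exists k, A `<=` square k].
Proof.
move=> mS Soo.
have cara (Q : set (plane R)) : measurable Q -> lebesgue_measurable2 Q.
  exact: caratheodory_measurable_mu_ext.
have [k k0] : exists k : nat,
    (0 < lebesgue_measure2 ((S `\` square m) `&` square k%:R))%E.
  apply: contrapT => /forallNP n0.
  have z k : lebesgue_measure2 ((S `\` square m) `&` square k%:R) = 0%E.
    apply/eqP; rewrite eq_le [X in _ && X]outer_measure_ge0 andbT leNgt.
    exact/negP/n0.
  have : (lebesgue_measure2 S <= area (square m))%E.
    rewrite (cara _ (measurable_square m) S) -[leRHS]adde0; apply: leeD.
      rewrite -(lebesgue_measure2E (measurable_square m)).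
      apply: le_outer_measure; exact: subIsetr.
    rewrite -setDE.
    have -> : S `\` square m = \bigcup_k ((S `\` square m) `&` square k%:R).
      rewrite -setI_bigcupr; apply/esym/setIidPl => p _.
      exists (Num.truncn (Num.max `|p.1| `|p.2|)).+1 => //.
      have := truncnS_gt (Num.max `|p.1| `|p.2|); rewrite gt_max => /andP[p1 p2].
      by split; rewrite /= in_itv/= -ler_norml ltW.
    apply: le_trans (outer_measure_sigma_subadditive _ _) _.
    by rewrite eseries0// => i _ _; exact: z.
  by rewrite Soo leNgt area_square_lty.
have [||A [mA AU A0]] := inner_borel_subset _ k0 (measurable_square k%:R) (area_square_lty _).
- pose mu : {outer_measure set (plane R) -> \bar R} := mu_ext area.
  have mSm : mu.-caratheodory (S `\` square m).
    apply: caratheodory_measurable_setD => //.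
    exact: (cara _ (measurable_square m)).
  apply: (caratheodory_measurable_setI mSm).
  exact: (cara _ (measurable_square k%:R)).
- exact: subIsetr.
by exists A; split => //; [move=> p /AU[]|exists k%:R => p /AU[]].
Qed.

End inner_borel_sets.

(** * Boxes almost filled by a set of positive measure *)

Section dense_squares.
Context {R : realType}.

(** [length B] is an infimum over the covers of [B] by intervals: if the bound
    [c * length] held for all intervals, it would pass to [nu B]. *)
Lemma exists_dense_interval (nu : {measure set (measurableTypeR R) -> \bar R})
    (c : R) (B : set (measurableTypeR R)) :
  0 < c -> measurable B -> (c%:E * length B < nu B)%E ->
  exists a b, a < b /\ ((c * (b - a))%:E < nu [set` `]a, b]])%E.
Proof.
move=> c0 mB; apply: contraPP => /forallNP n1.
have le a b : a < b -> (nu [set` `]a, b]] <= (c * (b - a))%:E)%E.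
  by move=> ab; rewrite leNgt; apply/negP => lt; apply: (n1 a); exists b.
apply/negP; rewrite -leNgt -lee_pdivrMl//.
apply: le_ereal_inf_tmp => _ [F [mF BF] <-].
have mF' i : measurable (F i : set (measurableTypeR R)).
  exact: sub_sigma_algebra.
rewrite lee_pdivrMl// -nneseriesZl//.
have nuBF : (nu B <= \sum_(i <oo) nu (F i))%E.
  exact: measure_sigma_subadditive.
apply: le_trans nuBF _; apply: lee_nneseries => // i _.
have := mF i; move=> /ocitvP[->|[[a b] /= ab ->]].
  by rewrite !measure0 mule0.
by rewrite wlength_itv_bnd ?(ltW ab)// -EFinM; exact: le.
Qed.

(** At most [(b - a) / t + 1] intervals of length [t] cover [`]a, b]]: the
    excess [t] in the hypothesis pays for the last one, which may stick out. *)
Lemma exists_dense_subinterval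
    (nu : {measure set (measurableTypeR R) -> \bar R}) (c a b t : R) :
  0 < c -> a < b -> 0 < t ->
  ((c * (b - a + t))%:E < nu [set` `]a, b]])%E ->
  exists x, ((c * t)%:E < nu [set` `]x, (x + t)%R]])%E.
Proof.
move=> c0 ab t0; apply: contraPP => /forallNP n1.
have le x : (nu [set` `]x, (x + t)%R]] <= (c * t)%:E)%E.
  by rewrite leNgt; apply/negP; exact: n1.
have lem (m : nat) : (nu [set` `]a, (a + m%:R * t)%R]] <= (m%:R * (c * t))%:E)%E.
  elim: m => [|m IH].
    by rewrite !mul0r addr0 set_itv_ge ?bnd_simp ?ltxx// measure0.
  have -> : [set` `]a, (a + m.+1%:R * t)%R]] =
    [set` `]a, (a + m%:R * t)%R]] `|` [set` `](a + m%:R * t)%R, (a + m.+1%:R * t)%R]].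
    apply/seteqP; split => x /=; rewrite !in_itv/=.
      by move=> /andP[-> ->]; case: (leP x (a + m%:R * t)) => h; [left|right].
    have mt : 0 <= m%:R * t by rewrite mulr_ge0// ltW.
    rewrite -natr1 mulrDl mul1r.
    by move=> [/andP[ax xm]|/andP[mx xm]]; apply/andP; split; lra.
  apply: le_trans (measureU2 _ _ _) _ => //.
  rewrite -natr1 [in leRHS]mulrDl mul1r EFinD; apply: leeD => //.
  by rewrite mulrDl mul1r addrA; exact: le.
apply/negP; rewrite -leNgt.
pose m := (Num.truncn ((b - a) / t)).+1.
apply: (@le_trans _ _ (nu [set` `]a, (a + m%:R * t)%R]])).
  apply: le_measure; rewrite ?inE//.
  apply: subset_itvl; rewrite bnd_simp -lerBlDl -ler_pdivrMr//.
  exact/ltW/truncnS_gt.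
apply: le_trans (lem m) _; rewrite lee_fin mulrCA ler_pM2l// /m -natr1 mulrDl mul1r.
rewrite lerD2r -ler_pdivlMr// truncn_le// divr_ge0// ?subr_ge0// ltW//.
Qed.


Lemma measurable_setXT (X : set (measurableTypeR R)) :
  measurable X -> measurable (X `*` setT : set (plane R)).
Proof. by move=> mX; exact: measurableX. Qed.

Lemma measurable_setTX (Y : set (measurableTypeR R)) :
  measurable Y -> measurable (setT `*` Y : set (plane R)).
Proof. by move=> mY; exact: measurableX. Qed.

Lemma xsection_setITX (A : set (plane R)) (Y : set (measurableTypeR R)) x :
  xsection (A `&` (setT `*` Y)) x = xsection A x `&` Y.
Proof.
apply/seteqP; split => y; rewrite /xsection/= !inE/=.
  by move=> [? []].
by move=> [Axy Yy]; split => //; rewrite inE in Axy.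
Qed.

(** Intervals with rational endpoints are countably many, which makes it
    possible to choose one that serves many sections of a plane set at once. *)
Lemma exists_rat_dense_interval (D : set (measurableTypeR R)) (c : R) :
  0 < c < 1 -> measurable D -> (0 < length D < +oo)%E ->
  exists p q : rat, p < q /\
    ((c * (ratr q - ratr p))%:E < length (D `&` [set` `]ratr p, ratr q]]))%E.
Proof.
move=> /andP[c0 c1] mD /andP[D0 Doo].
have Df : length D \is a fin_num by rewrite ge0_fin_numE.
pose nu : {measure set (measurableTypeR R) -> \bar R} := mrestr length mD.
have nuE X : nu X = length (X `&` D) by [].
have [|a [b [ab]]] := @exists_dense_interval nu c D c0 mD.
  by rewrite nuE setIid -[ltRHS]mul1e lte_pmul2r.
rewrite nuE; set y := length _ => aby.
have yf : y \is a fin_num.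
  rewrite ge0_fin_numE ?measure_ge0//; apply: le_lt_trans Doo; apply: le_measure; rewrite ?inE//.
  exact: measurableI.
move: aby; rewrite -(fineK yf) lte_fin; set r := fine y => aby.
(* Widening both ends by less than [e] adds less than [r - c * (b - a)] to
   [c * (b - a)]. *)
pose e := (r - c * (b - a)) / (2 * c).
have e0 : 0 < e by rewrite divr_gt0 ?subr_gt0// mulr_gt0.
have [|p] := @rat_in_itvoo _ (a - e) a; first by rewrite ltrBlDr ltrDl.
rewrite in_itv/= => /andP[pl pr].
have [|q] := @rat_in_itvoo _ b (b + e); first by rewrite ltrDl.
rewrite in_itv/= => /andP[ql qr].
exists p, q; split.
  by rewrite -(@ltr_rat R); apply: lt_trans pr (lt_trans ab ql).
apply: (@lt_le_trans _ _ r%:E).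
  rewrite lte_fin; apply: (@lt_le_trans _ _ (c * (b - a + 2 * e))).
    rewrite ltr_pM2l//; lra.
  rewrite le_eqVlt; apply/orP; left; apply/eqP.
  by rewrite /e; field; rewrite gt_eqF.
rewrite /r fineK// /y; apply: le_measure; rewrite ?inE//.
- exact: measurableI.
- exact: measurableI.
rewrite setIC; apply: setIS => x; rewrite /= !in_itv/= => /andP[ax xb].
by rewrite (lt_trans pr ax) (le_trans xb (ltW ql)).
Qed.

Lemma first_marginal (A : set (plane R)) : measurable A ->
  exists nu : {measure set (measurableTypeR R) -> \bar R},
    forall X, nu X = area (A `&` (X `*` setT)).
Proof.
move=> mA; pose nu : {measure set (measurableTypeR R) -> \bar R} :=
  pushforward (mrestr area mA) (fst : plane R -> measurableTypeR R).
exists (nu measurable_fst) => X.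
have E : A `&` (X `*` setT) = fst @^-1` X `&` A.
  by apply/seteqP; split=> p /=; [move=> [? []]|move=> []].
by rewrite E.
Qed.

Lemma second_marginal (A : set (plane R)) : measurable A ->
  exists nu : {measure set (measurableTypeR R) -> \bar R},
    forall Y, nu Y = area (A `&` (setT `*` Y)).
Proof.
move=> mA; pose nu : {measure set (measurableTypeR R) -> \bar R} :=
  pushforward (mrestr area mA) (snd : plane R -> measurableTypeR R).
exists (nu measurable_snd) => X.
have E : A `&` (setT `*` X) = snd @^-1` X `&` A.
  by apply/seteqP; split=> p /=; [move=> [? []]|move=> []].
by rewrite E.
Qed.

(** For each [x] whose section [xsection A x] has positive length, some rational
    interval is mostly filled by that section. As these intervals are countably
    many, one of them works for all [x] in a set [E] of positive length, and
    the part of [A] above it has a first marginal that is large on [E]; so it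
    is large on some interval. *)
Lemma exists_dense_rectangle (A : set (plane R)) (k c : R) :
  0 < c < 1 -> measurable A -> A `<=` square k -> (0 < area A)%E ->
  exists a b a' b', [/\ a < b, a' < b' &
   ((c * (b - a) * (b' - a'))%:E <
     area (A `&` ([set` `]a, b]] `*` [set` `]a', b']])))%E].
Proof.
move=> /andP[c0 c1] mA Ak A0; pose c' := (c + 1) / 2.
have c'0 : 0 < c' by rewrite /c'; lra.
have c'1 : c' < 1 by rewrite /c'; lra.
have cc' : c < c' by rewrite /c'; lra.
pose J (pq : rat * rat) : set (measurableTypeR R) := [set` `]ratr pq.1, ratr pq.2]].
have mJ pq : measurable (J pq) by exact: measurable_itv.
pose g pq x := length (xsection (A `&` (setT `*` J pq)) x).
have mAJ pq : measurable (A `&` (setT `*` J pq)).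
  by apply: measurableI => //; exact: measurable_setTX.
have mg pq : measurable_fun setT (g pq) by exact: measurable_fun_xsection.
pose E pq := [set x | ((c' * (ratr pq.2 - ratr pq.1))%:E < g pq x)%E].
have mE pq : measurable (E pq).
  rewrite -[X in measurable X]setTI; exact: emeasurable_fun_o_infty.
have Axk x : xsection A x `<=` [set` `[- k, k]].
  by move=> y; rewrite /xsection/= inE => /Ak[].
have Axoo x : (length (xsection A x) < +oo)%E.
  apply: (@le_lt_trans _ _ (length [set` `[- k, k]])).
    apply: le_measure; rewrite ?inE//.
    exact: measurable_xsection.
  rewrite lebesgue_measure_itv/=; case: ifPn => _ //.
  by rewrite -EFinB ltry.
have [pq [pq_lt pq0]] : exists pq : rat * rat, pq.1 < pq.2 /\ (0 < length (E pq))%E.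
  apply: contrapT => /forallNP n0.
  have z pq : pq.1 < pq.2 -> length.-negligible (E pq).
    move=> lt; apply/negligibleP => //; apply/eqP; rewrite eq_le measure_ge0 andbT.
    by rewrite leNgt; apply/negP => gt; exact: (n0 pq).
  pose F n := if unpickle n is Some pq then
    if (pq : rat * rat).1 < pq.2 then E pq else set0 else set0.
  have Fz n : length.-negligible (F n).
    rewrite /F; case: (unpickle n) => [pq|]; last exact: negligible_set0.
    by case: ifPn => [/z //|_]; exact: negligible_set0.
  have : area A = 0%E.
    rewrite /product_measure1 (@ae_eq_integral _ _ R length setT (cst 0%E))//.
    - exact: integral0.
    - exact: measurable_fun_xsection.
    - apply: negligibleS (negligible_bigcup Fz) => x /= nx.
      have c'01 : 0 < c' < 1 by rewrite c'0.
      have Ax0 : (0 < length (xsection A x) < +oo)%E.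
        by rewrite Axoo andbT lt0e measure_ge0 andbT; apply/eqP => e0; exact: nx.
      have [p [q [pq gt]]] :=
        exists_rat_dense_interval c'01 (measurable_xsection x mA) Ax0.
      have FE : F (pickle (p, q)) = E (p, q) by rewrite /F pickleK /= pq.
      exists (pickle (p, q)); first exact: I.
      rewrite FE /E /mkset /g.
      by rewrite xsection_setITX.
  by move=> A00; rewrite A00 ltxx in A0.
have gp : 0 < ratr pq.2 - ratr pq.1 :> R by rewrite subr_gt0 ltr_rat.
set d := ratr pq.2 - ratr pq.1 in gp.
have Eoo : (length (E pq) < +oo)%E.
  apply: (@le_lt_trans _ _ (length [set` `[- k, k]])).
    apply: le_measure; rewrite ?inE// => x; rewrite /E/= -/d => gx.
    have : (0 < g pq x)%E by apply: le_lt_trans gx; rewrite lee_fin mulr_ge0 ?ltW.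
    apply: contraPP => nx; rewrite /g (_ : xsection _ _ = set0) ?measure0 ?ltxx//.
    apply/seteqP; split => y //; rewrite /xsection/= inE => -[/Ak[/= xk _] _].
    exact: nx.
  rewrite lebesgue_measure_itv/=; case: ifPn => _ //.
  by rewrite -EFinB ltry.
have Ef : length (E pq) \is a fin_num by rewrite ge0_fin_numE.
have [nu nuE] := first_marginal (mAJ pq).
have cd : 0 < c * d by rewrite mulr_gt0.
have [|a [b [ab]]] := @exists_dense_interval nu (c * d) (E pq) cd (mE pq).
  apply: (@lt_le_trans _ _ ((c' * d)%:E * length (E pq))%E).
    by rewrite lte_pmul2r// lte_fin ltr_pM2r.
  rewrite nuE /product_measure1 -integral_cst//.
  rewrite integral_mkcond; apply: ge0_le_integral => //.
  - by move=> x _; apply: erestrict_ge0 => y _; rewrite lee_fin mulr_ge0 ?ltW.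
  - apply/(measurable_restrictT _ (mE pq)); exact: measurable_cst.
  - apply: measurable_fun_xsection; apply: measurableI => //.
    exact: measurable_setXT.
  - move=> x _; rewrite patchE; case: ifPn; rewrite ?inE => Ex.
      move: (Ex); rewrite /E/= -/d => gx; apply: le_trans (ltW gx) _.
      rewrite /g; apply: le_measure; rewrite ?inE.
      + exact: measurable_xsection.
      + apply: measurable_xsection; apply: measurableI => //.
        exact: (measurable_setXT (mE pq)).
      by move=> y; rewrite /xsection/= !inE.
    exact: measure_ge0.
rewrite nuE => abgt; exists a, b, (ratr pq.1), (ratr pq.2); split => //.
  by rewrite ltr_rat.
rewrite -/d; rewrite mulrAC in abgt; apply: lt_le_trans abgt _.
apply: le_measure; rewrite ?inE.
- by apply: measurableI => //; exact: measurable_setXT.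
- by apply: measurableI => //; exact: measurableX.
by move=> [x y] [[Axy [_ Jy]] [xab _]]; split.
Qed.

End dense_squares.

Section dense_boxes.
Context {R : realType}.

(** Half-open, so that boxes whose centers differ by [2 * r] in some coordinate
    are disjoint. *)
Definition box (q : R * R) (r : R) : set (plane R) :=
  [set` `]q.1 - r, q.1 + r]] `*` [set` `]q.2 - r, q.2 + r]].

Lemma measurable_box q r : measurable (box q r).
Proof. exact: measurableX. Qed.

Lemma area_box q r : 0 < r -> area (box q r) = (4 * r ^+ 2)%:E.
Proof.
move=> r0; have lt x : x - r < x + r by lra.
rewrite area_setX// !lebesgue_measure_itv/= !lte_fin !lt -!EFinB -EFinM.
by congr EFin; ring.
Qed.

(** A dense rectangle is paved by squares that are tiny compared to its sides,
    one direction after the other. *)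
Lemma exists_dense_square (A : set (plane R)) (k c t0 : R) :
  0 < c < 1 -> 0 < t0 -> measurable A -> A `<=` square k -> (0 < area A)%E ->
  exists x y t : R, 0 < t < t0 /\ ((c * t * t)%:E <
    area (A `&` ([set` `]x, (x + t)%R]] `*` [set` `]y, (y + t)%R]])))%E.
Proof.
move=> /andP[c0 c1] t00 mA Ak A0.
(* Squares of side at most [s] times those of the rectangle pave it up to a
   factor [(1 + s) ^+ 2], and [s] is such that [(1 + s) ^+ 2 * c < 1]. *)
pose s := (1 - c) / 4; have s0 : 0 < s by rewrite /s; lra.
have cs : 0 < (1 + s) ^+ 2 * c < 1.
  have -> : c = 1 - 4 * s by rewrite /s; field.
  have c4 : 0 < 1 - 4 * s by rewrite /s; lra.
  have s1 : 0 < 1 + s by rewrite addr_gt0.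
  apply/andP; split; first by rewrite mulr_gt0// exprn_gt0.
  have -> : (1 + s) ^+ 2 * (1 - 4 * s) =
      1 - (2 * s + 7 * s ^+ 2 + 4 * s ^+ 3) by ring.
  by rewrite ltrBlDr ltrDl !addr_gt0// mulr_gt0// exprn_gt0.
have [a [b [a' [b' [ab ab' dense]]]]] := exists_dense_rectangle cs mA Ak A0.
pose u := b - a; pose v := b' - a'.
have u0 : 0 < u by rewrite subr_gt0.
have v0 : 0 < v by rewrite subr_gt0.
pose t := Num.min t0 (s * Num.min u v) / 2.
have m0 : 0 < Num.min t0 (s * Num.min u v).
  by rewrite lt_min t00/= mulr_gt0// lt_min u0.
have t_gt0 : 0 < t by rewrite divr_gt0.
have tm : t <= Num.min t0 (s * Num.min u v) by rewrite /t; lra.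
have tt0 : t < t0.
  have : Num.min t0 (s * Num.min u v) <= t0 by rewrite ge_min lexx.
  rewrite /t; lra.
have tsu : t <= s * u.
  apply: le_trans tm _; rewrite ge_min ler_pM2l//.
  by rewrite [X in _ || X]ge_min lexx orbT.
have tsv : t <= s * v.
  apply: le_trans tm _; rewrite ge_min ler_pM2l//.
  by rewrite [X in _ || X]ge_min lexx !orbT.
have mAJ : measurable (A `&` (setT `*` [set` `]a', b']])).
  by apply: measurableI => //; exact: measurable_setTX.
have [nu nuE] := first_marginal mAJ.
have [||||x] := @exists_dense_subinterval _ nu (c * (v + t)) a b t => //.
- by rewrite mulr_gt0// addr_gt0.
- rewrite nuE -/u.
  apply: le_lt_trans (lt_le_trans dense _).
    rewrite lee_fin -/u -/v.
    have -> : (1 + s) ^+ 2 * c * u * v = c * ((1 + s) * v) * ((1 + s) * u) by ring.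
    apply: ler_pM.
    + by rewrite ltW// mulr_gt0// addr_gt0.
    + by rewrite ltW// addr_gt0.
    + by rewrite ler_pM2l//; lra.
    + lra.
  apply: le_measure; rewrite ?inE.
  + by apply: measurableI => //; exact: measurableX.
  + by apply: measurableI => //; exact: measurable_setXT.
  + by move=> [z1 z2] [Az [/= z1ab z2ab]].
rewrite nuE => dx.
have mAI : measurable (A `&` ([set` `]x, (x + t)%R]] `*` setT)).
  by apply: measurableI => //; exact: measurable_setXT.
have [nu' nuE'] := second_marginal mAI.
have [||||y] := @exists_dense_subinterval _ nu' (c * t) a' b' t => //.
- by rewrite mulr_gt0.
- rewrite nuE' -/v mulrAC; apply: lt_le_trans dx _.
  apply: le_measure; rewrite ?inE.
  + by apply: measurableI => //; exact: measurable_setXT.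
  + by apply: measurableI => //; exact: measurable_setTX.
  + by move=> [z1 z2] [[Az [_ /= z2ab]] [z1x _]].
rewrite nuE' => dy; exists x, y, t; split; first by rewrite t_gt0.
apply: lt_le_trans dy _; apply: le_measure; rewrite ?inE.
- by apply: measurableI => //; exact: measurable_setTX.
- by apply: measurableI => //; exact: measurableX.
- by move=> [z1 z2] [[Az [z1x _]] [_ z2y]].
Qed.

(** A weak form of the density theorem: the radius can be taken small, but it is
    not claimed that all small radii work. *)
Lemma exists_dense_box (A : set (plane R)) (k eps r0 : R) :
  0 < eps < 1 -> 0 < r0 -> measurable A -> A `<=` square k -> (0 < area A)%E ->
  exists (q : R * R) (r : R), 0 < r < r0 /\
    (area (box q r `\` A) < (eps * (4 * r ^+ 2))%:E)%E.
Proof.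
move=> /andP[e0 e1] r00 mA Ak A0.
have c01 : 0 < 1 - eps < 1 by apply/andP; split; lra.
have t00 : 0 < 2 * r0 by rewrite mulr_gt0.
have [x [y [t [/andP[t_gt0 tt0] dense]]]] := exists_dense_square c01 t00 mA Ak A0.
pose r := t / 2; have rt : t = 2 * r by rewrite /r; field.
have r_gt0 : 0 < r by rewrite divr_gt0.
pose q := (x + r, y + r).
exists q, r; rewrite r_gt0/=; split; first by lra.
have : area (box q r) = (area (box q r `\` A) +
    area (box q r `&` A))%E.
  by apply: measureDI => //; exact: measurable_box.
rewrite area_box//.
have bE : box q r = [set` `]x, (x + t)%R]] `*` [set` `]y, (y + t)%R]].
  by rewrite /box /q/= !addrK -!addrA -[r + r]mulr2n -mulr_natl -rt.
rewrite -bE setIC in dense.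
have If : area (box q r `&` A) \is a fin_num.
  rewrite ge0_fin_numE ?measure_ge0//.
  apply: le_lt_trans (ltry (4 * r ^+ 2)); rewrite -(area_box q r_gt0).
  apply: le_measure; rewrite ?inE//; last exact: measurable_box.
  by apply: measurableI => //; exact: measurable_box.
have Df : area (box q r `\` A) \is a fin_num.
  rewrite ge0_fin_numE ?measure_ge0//.
  apply: le_lt_trans (ltry (4 * r ^+ 2)); rewrite -(area_box q r_gt0).
  apply: le_measure; rewrite ?inE//; last exact: measurable_box.
  by apply: measurableD => //; exact: measurable_box.
move: dense; rewrite -(fineK If) -(fineK Df) -EFinD !lte_fin => dense [] E.
have rr : t * t = 4 * r ^+ 2 by rewrite rt; ring.
rewrite -mulrA rr in dense; lra.
Qed.

End dense_boxes.

(** * Isosceles triangles of area one with a given apex *)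

Section inversion.
Context {R : realType}.
Implicit Types X Y : R * R.

Definition sqnorm X : R := X.1 ^+ 2 + X.2 ^+ 2.

(** The inversion followed by a quarter turn: a vector orthogonal to [X] with
    the inverse of its length. It is half of the base of an isosceles triangle
    of area [1] whose height is [X]. *)
Definition turned_inversion X : R * R := (- X.2 / sqnorm X, X.1 / sqnorm X).

Lemma sqr_le_norm (x y : R) : 0 <= y -> x ^+ 2 <= y ^+ 2 -> `|x| <= y.
Proof.
by move=> y0 xy; rewrite -ler_sqr ?nnegrE ?normr_ge0// real_normK ?num_real.
Qed.

Lemma turned_inversion_small X (r : R) : 0 < r -> 0 < sqnorm X ->
  4 <= r ^+ 2 * sqnorm X ->
  `|(turned_inversion X).1| <= r / 2 /\ `|(turned_inversion X).2| <= r / 2.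
Proof.
case: X => x y; rewrite /turned_inversion /sqnorm/=; set N := x ^+ 2 + y ^+ 2.
move=> r0 N0 rN.
have le (z : R) : z ^+ 2 <= N -> `|z / N| <= r / 2.
  move=> zN; apply: sqr_le_norm; first by rewrite divr_ge0// ltW.
  rewrite !expr_div_n ler_pdivrMr ?exprn_gt0//; nra.
have x0 := sqr_ge0 x; have y0 := sqr_ge0 y.
split; apply: le; rewrite ?sqrrN /N; lra.
Qed.

(** The inversion satisfies [|X / |X|^2 - Y / |Y|^2| = |X - Y| / (|X| * |Y|)] for
    the Euclidean norm. As [|X|] and [|Y|] are at least [2], this leaves room for
    the comparison with the sup norm. *)
Lemma turned_inversion_contracts X Y (m : R) :
  4 <= sqnorm X -> 4 <= sqnorm Y ->
  `|X.1 - Y.1| <= m -> `|X.2 - Y.2| <= m ->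
  `|(turned_inversion X).1 - (turned_inversion Y).1| <= m / 2 /\
  `|(turned_inversion X).2 - (turned_inversion Y).2| <= m / 2.
Proof.
case: X Y => x y [z w]; rewrite /turned_inversion /sqnorm/=.
set N := x ^+ 2 + y ^+ 2; set M := z ^+ 2 + w ^+ 2 => N4 M4 xz yw.
have m0 : 0 <= m by apply: le_trans xz.
have N0 : N != 0 by rewrite gt_eqF//; lra.
have M0 : M != 0 by rewrite gt_eqF//; lra.
pose p := - y / N - - w / M; pose q := x / N - z / M.
have E : p ^+ 2 + q ^+ 2 = ((x - z) ^+ 2 + (y - w) ^+ 2) / (N * M).
  by rewrite /p /q; move: N0 M0; rewrite /N /M => N0 M0; field; rewrite N0 M0.
have sq (v : R) : `|v| <= m -> v ^+ 2 <= m ^+ 2.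
  by move=> vm; rewrite -(real_normK (num_real v)) ler_sqr ?nnegrE ?normr_ge0.
have bound : p ^+ 2 + q ^+ 2 <= (m / 2) ^+ 2.
  rewrite E ler_pdivrMr; last by rewrite mulr_gt0//; lra.
  have NM : 8 <= N * M by nra.
  have := sq _ xz; have := sq _ yw; have := sqr_ge0 m; rewrite expr_div_n.
  set a := (x - z) ^+ 2; set b := (y - w) ^+ 2; set c := m ^+ 2; nra.
have p0 := sqr_ge0 p; have q0 := sqr_ge0 q.
by split; apply: sqr_le_norm; rewrite ?divr_ge0// -/p -/q; lra.
Qed.

End inversion.

Section grid.
Context {R : realType}.

Lemma sum_area_disjoint_boxes (I : finType) (z : I -> R * R)
    (P Q : set (plane R)) (d : R) : measurable P -> measurable Q ->
  (forall i j, i != j -> 2 * d <= `|(z i).1 - (z j).1| \/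
                         2 * d <= `|(z i).2 - (z j).2|) ->
  (forall i, box (z i) d `<=` Q) ->
  (\sum_(i : I) area (box (z i) d `\` P) <= area (Q `\` P))%E.
Proof.
move=> mP mQ sep sub.
have mB i : measurable (box (z i) d `\` P).
  by apply: measurableD => //; exact: measurable_box.
have mU : measurable (\bigcup_(i in [set: I]) (box (z i) d `\` P)).
  by apply: fin_bigcup_measurable => //; exact: finite_finset.
have <- : area (\bigcup_(i in [set: I]) (box (z i) d `\` P)) =
    (\sum_(i : I) area (box (z i) d `\` P))%E.
  rewrite [RHS]fsbig_seq ?index_enum_uniq// measure_fin_bigcup//.
    by apply: eq_fsbigl; apply/seteqP; split => i //= _; rewrite mem_index_enum.
    exact: finite_finset.
  apply/trivIsetP => i j _ _ ij; apply/seteqP; split => // p.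
  move=> [[[/= + +] _] [[/= + +] _]]; rewrite !in_itv/=.
  move=> /andP[a1 a2] /andP[a3 a4] /andP[b1 b2] /andP[b3 b4].
  by case: (sep _ _ ij); rewrite real_ler_normr ?num_real// => /orP[]; lra.
apply: le_measure; rewrite ?inE//; first exact: measurableD.
by move=> p [i _ [zp nP]]; split => //; exact: sub zp.
Qed.

Definition displacement (q x : R * R) : R * R := (x.1 - q.1, x.2 - q.2).

(** For [s = 1] and [s = -1], the base vertices of the isosceles triangle of area
    [1] with apex [q] and with [x] as the midpoint of its base. *)
Definition base_vertex (q : R * R) (s : R) (x : R * R) : R * R :=
  (x.1 + s * (turned_inversion (displacement q x)).1,
   x.2 + s * (turned_inversion (displacement q x)).2).

(** The identity plus a map with Lipschitz constant [1 / 2]. *)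
Lemma base_vertex_expands (q x y : R * R) (s e : R) : `|s| = 1 ->
  4 <= sqnorm (displacement q x) -> 4 <= sqnorm (displacement q y) ->
  e <= `|x.1 - y.1| \/ e <= `|x.2 - y.2| ->
  e / 2 <= `|(base_vertex q s x).1 - (base_vertex q s y).1| \/
  e / 2 <= `|(base_vertex q s x).2 - (base_vertex q s y).2|.
Proof.
move=> s1 x4 y4 exy; set m := Num.max `|x.1 - y.1| `|x.2 - y.2|.
have em : e <= m by rewrite le_max; case: exy => ->; rewrite ?orbT.
have dE (i j k : R) : i - k - (j - k) = i - j by ring.
have [||c1 c2] := turned_inversion_contracts (m := m) x4 y4.
- by rewrite /= dE le_max lexx.
- by rewrite /= dE le_max lexx orbT.
have sE (i j a b : R) : `|a - b| <= m / 2 -> `|i - j| = m ->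
    e / 2 <= `|i + s * a - (j + s * b)|.
  move=> ab ij.
  have -> : i + s * a - (j + s * b) = (i - j) + s * (a - b) by ring.
  have : m <= `|(i - j) + s * (a - b)| + `|a - b|.
    rewrite -ij -[`|a - b|]mul1r -s1 -normrM -[X in X <= _](congr1 Num.norm (addrK (s * (a - b)) _)).
    exact: ler_normB.
  lra.
have [mE|mE] : m = `|x.1 - y.1| \/ m = `|x.2 - y.2|.
  by rewrite /m; case: (leP `|x.1 - y.1| `|x.2 - y.2|) => _; [right|left].
- by left; apply: sE.
- by right; apply: sE.
Qed.

(** Pigeonhole principle on the points [x] of a grid of mesh [8 * d]: for each of
    the two signs the boxes around the base vertices are disjoint and contained
    in the large box, so the areas that [P] misses in them add up to at most
    [r ^+ 2 / 512]. The grid has more than [(r / (16 * d)) ^+ 2] points, so the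
    failure at each of them would require a total of more than
    [r ^+ 2 / 256]. *)
Lemma exists_dense_base (P : set (plane R)) (p q : R * R) (r d : R) :
  measurable P -> 0 < d -> 8 * d <= r ->
  (area (box p (2 * r) `\` P) < (r ^+ 2 / 512)%:E)%E ->
  (forall x, `|x.1 - p.1| <= r -> `|x.2 - p.2| <= r ->
     4 <= sqnorm (displacement q x) /\ 4 <= r ^+ 2 * sqnorm (displacement q x)) ->
  exists x, [/\ `|x.1 - p.1| <= r, `|x.2 - p.2| <= r,
    (area (box (base_vertex q 1 x) (2 * d) `\` P) < (d ^+ 2)%:E)%E &
    (area (box (base_vertex q (-1) x) (2 * d) `\` P) < (d ^+ 2)%:E)%E].
Proof.
move=> mP d0 dr dense far.
have r0 : 0 < r by lra.
have d80 : 0 < 8 * d by lra.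
pose n := Num.truncn (r / (8 * d)).
have nr : n%:R * (8 * d) <= r.
  by rewrite -ler_pdivlMr// truncn_le// divr_ge0// ltW.
have rn : r < n.+1%:R * (8 * d) by rewrite -ltr_pdivrMr// truncnS_gt.
have n1 : (1 : R) <= n%:R.
  by rewrite ler1n lt0n; apply: contraPneq rn => ->; rewrite mul1r; lra.
have rn16 : r < n%:R * (16 * d).
  apply: lt_le_trans rn _; rewrite -natr1; nra.
pose x (ij : 'I_n * 'I_n) : R * R :=
  (p.1 + ij.1%:R * (8 * d), p.2 + ij.2%:R * (8 * d)).
have grid (i : 'I_n) : 0 <= i%:R * (8 * d) <= r - 8 * d.
  apply/andP; split; first by rewrite mulr_ge0// ltW.
  rewrite lerBrDr -[X in _ + X]mul1r -mulrDl natr1.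
  by apply: le_trans nr; rewrite ler_pM2r// ler_nat.
have xr1 ij : `|(x ij).1 - p.1| <= r.
  by rewrite /= addrC addKr; have /andP[? ?] := grid ij.1; rewrite ger0_norm//; lra.
have xr2 ij : `|(x ij).2 - p.2| <= r.
  by rewrite /= addrC addKr; have /andP[? ?] := grid ij.2; rewrite ger0_norm//; lra.
have sum (s : R) : `|s| = 1 ->
    (\sum_(ij : 'I_n * 'I_n) area (box (base_vertex q s (x ij)) (2 * d) `\` P) <=
      area (box p (2 * r) `\` P))%E.
  move=> s1; apply: sum_area_disjoint_boxes => //; first exact: measurable_box.
    move=> ij kl ne.
    have -> : 2 * (2 * d) = 8 * d / 2 by field.
    apply: base_vertex_expands => //.
    - by have [] := far _ (xr1 ij) (xr2 ij).
    - by have [] := far _ (xr1 kl) (xr2 kl).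
    have sep (i j : 'I_n) (c : R) : i != j ->
        8 * d <= `|c + i%:R * (8 * d) - (c + j%:R * (8 * d))|.
      move=> ij'; rewrite opprD addrACA subrr add0r -mulrBl normrM (gtr0_norm d80).
      rewrite -[leLHS]mul1r ler_pM2r//.
      have nat_sep (a b : nat) : (a < b)%N -> (1 : R) <= `|b%:R - a%:R|.
        by move=> lt; rewrite -natrB ?(ltnW lt)// normr_nat ler1n subn_gt0.
      by have /orP[ji|ji] : (i < j)%N || (j < i)%N by [rewrite -neq_ltn|];
        [rewrite distrC|]; exact: nat_sep.
    move: ij kl ne => [i j] [k l]; rewrite xpair_eqE negb_and => /orP[ne|ne].
      by left; exact: sep.
    by right; exact: sep.
  move=> ij [y1 y2]; have [n4 f] := far _ (xr1 ij) (xr2 ij).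
  have sq0 : 0 < sqnorm (displacement q (x ij)) by apply: lt_le_trans n4.
  have := turned_inversion_small r0 sq0 f.
  rewrite /base_vertex; case: (turned_inversion _) => t1 t2 /= small.
  have sle (a : R) : `|a| <= r / 2 -> - (r / 2) <= s * a <= r / 2.
    by move=> ar; rewrite -ler_norml normrM s1 mul1r.
  have [/sle/andP[c1 c2] /sle/andP[c3 c4]] := small.
  have /andP[g1 g2] := grid ij.1; have /andP[g3 g4] := grid ij.2.
  move=> [/=]; rewrite !in_itv/= => /andP[a1 a2] /andP[b1 b2].
  by clear -r0 dr c1 c2 c3 c4 g1 g2 g3 g4 a1 a2 b1 b2;
     split; rewrite /= in_itv/=; apply/andP; split; lra.
apply: contrapT => /forallNP none.
have big ij : ((d ^+ 2)%:E <= area (box (base_vertex q 1 (x ij)) (2 * d) `\` P) +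
    area (box (base_vertex q (-1) (x ij)) (2 * d) `\` P))%E.
  rewrite leNgt; apply/negP => lt; apply: (none (x ij)); split => //.
    by apply: le_lt_trans lt; rewrite leeDl// measure_ge0.
  by apply: le_lt_trans lt; rewrite leeDr// measure_ge0.
have : (\sum_(ij : 'I_n * 'I_n) (d ^+ 2)%:E <= (r ^+ 2 / 512)%:E + (r ^+ 2 / 512)%:E)%E.
  apply: le_trans (lee_sum _ (fun ij _ => big ij)) _.
  rewrite big_split/=; apply: leeD; apply: le_trans (ltW dense); apply: sum.
    by rewrite normr1.
  by rewrite normrN1.
rewrite sumEFin sumr_const card_prod card_ord -EFinD lee_fin -[leLHS]mulr_natr natrM.
have : r ^+ 2 < (n%:R * (16 * d)) ^+ 2 by rewrite ltr_sqr ?nnegrE ?ltW//; lra.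
rewrite exprMn exprMn; lra.
Qed.

End grid.

(** * Opening the triangle into a trapezoid *)

Section assembly.
Context {R : realType}.

(** The translations by vectors of [box (0, 0) d] form a set of area
    [4 * d ^+ 2], too large to be covered by the four sets of those that fail for
    one of the points. *)
Lemma exists_common_translate (B : set (plane R)) (d : R) (z1 z2 z3 z4 : R * R) :
  measurable B -> 0 < d ->
  (area (box z1 d `\` B) < (d ^+ 2)%:E)%E ->
  (area (box z2 d `\` B) < (d ^+ 2)%:E)%E ->
  (area (box z3 d `\` B) < (d ^+ 2)%:E)%E ->
  (area (box z4 d `\` B) < (d ^+ 2)%:E)%E ->
  exists t : R * R, [/\ B (t.1 + z1.1, t.2 + z1.2), B (t.1 + z2.1, t.2 + z2.2),
    B (t.1 + z3.1, t.2 + z3.2) & B (t.1 + z4.1, t.2 + z4.2)].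
Proof.
move=> mB d0 b1 b2 b3 b4; apply: contrapT => /forallNP none.
pose bad (z : R * R) : set (plane R) :=
  (fun t => (t.1 + z.1, t.2 + z.2)) @^-1` (box z d `\` B).
have mbox z : measurable (box z d `\` B).
  by apply: measurableD => //; exact: measurable_box.
have mbad z : measurable (bad z).
  have [mf _] := area_preserving_translate (z : plane R).
  by rewrite -[X in measurable X]setTI; exact: mf.
have bad_small z : (area (box z d `\` B) < (d ^+ 2)%:E)%E ->
    (area (bad z) < (d ^+ 2)%:E)%E.
  have [_ af] := area_preserving_translate (z : plane R).
  by have -> : area (bad z) = area (box z d `\` B) by exact: af (mbox z).
have badP (z t : R * R) : box (0, 0) d t -> ~ B (t.1 + z.1, t.2 + z.2) -> bad z t.
  move=> [/=]; rewrite !in_itv/= => /andP[s1 s2] /andP[s3 s4] nB; split => //.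
  by split; rewrite /= in_itv/=; apply/andP; split; lra.
have cover : box (0, 0) d `<=` bad z1 `|` bad z2 `|` bad z3 `|` bad z4.
  move=> t bt; have [B1|/(badP _ _ bt)] := pselect (B (t.1 + z1.1, t.2 + z1.2));
    last by left; left; left.
  have [B2|/(badP _ _ bt)] := pselect (B (t.1 + z2.1, t.2 + z2.2));
    last by left; left; right.
  have [B3|/(badP _ _ bt)] := pselect (B (t.1 + z3.1, t.2 + z3.2));
    last by left; right.
  have [B4|/(badP _ _ bt)] := pselect (B (t.1 + z4.1, t.2 + z4.2));
    last by right.
  by exfalso; apply: (none t).
have mU2 : measurable (bad z1 `|` bad z2) by exact: measurableU.
have mU3 : measurable (bad z1 `|` bad z2 `|` bad z3) by exact: measurableU.
have e1 := bad_small _ b1; have e2 := bad_small _ b2.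
have e3 := bad_small _ b3; have e4 := bad_small _ b4.
have lt2 := le_lt_trans (measureU2 area (mbad z1) (mbad z2)) (lteD e1 e2).
have lt3 := le_lt_trans (measureU2 area mU2 (mbad z3)) (lteD lt2 e3).
have lt4 := le_lt_trans (measureU2 area mU3 (mbad z4)) (lteD lt3 e4).
have : (area (box (0, 0)%R d) < (d ^+ 2)%:E + (d ^+ 2)%:E + (d ^+ 2)%:E + (d ^+ 2)%:E)%E.
  apply: le_lt_trans lt4; apply: le_measure; rewrite ?inE//; first exact: measurable_box.
  exact: measurableU.
by rewrite area_box// -!EFinD lte_fin; lra.
Qed.

Lemma isosceles_trapezoid_frame (c u : R * R) (h V w : R) :
  u.1 ^+ 2 + u.2 ^+ 2 = 1 -> 0 < h -> 0 < w -> w < V ->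
  isosceles_trapezoid (of_frame c u (0, - V)) (of_frame c u (0, V))
    (of_frame c u (h, w)) (of_frame c u (h, - w)).
Proof.
move=> u1 h0 w0 wV; have V0 : 0 < V by lra.
have Vw : 0 < V - w by lra.
(* The distance from the long base to the point where the legs meet. *)
pose H := h * V / (V - w).
have H0 : 0 < H by rewrite divr_gt0// mulr_gt0.
have t01 : 0 < (V - w) / V < 1.
  by rewrite divr_gt0//= ltr_pdivrMr// mul1r; lra.
exists (of_frame c u (H, 0)); split; first split.
- rewrite /parallel /of_frame/=; set l := (X in X = _); set r := RHS => lr.
  have : l - r = - (2 * V * H) * (u.1 ^+ 2 + u.2 ^+ 2) by rewrite /l /r; ring.
  rewrite lr subrr u1 mulr1 => /esym/eqP; rewrite oppr_eq0 => /eqP VH.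
  have VH0 : 0 < 2 * V * H by rewrite mulr_gt0// mulr_gt0.
  by rewrite VH ltxx in VH0.
- rewrite /euclidean_dist /of_frame/=; congr Num.sqrt.
  by ring.
- exists ((V - w) / V) => //.
  by rewrite /of_frame /H/=; congr pair; field; rewrite !gt_eqF.
- exists ((V - w) / V) => //.
  by rewrite /of_frame /H/=; congr pair; field; rewrite !gt_eqF.
- by rewrite /parallel /of_frame/=; ring.
Qed.

Lemma area_box_diff_subset (B : set (plane R)) (z c : R * R) (d : R) :
  measurable B -> `|z.1 - c.1| <= d -> `|z.2 - c.2| <= d ->
  (area (box z d `\` B) <= area (box c (2 * d) `\` B))%E.
Proof.
move=> mB; rewrite !ler_norml => /andP[l1 u1] /andP[l2 u2].
apply: le_measure; rewrite ?inE.
- by apply: measurableD => //; exact: measurable_box.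
- by apply: measurableD => //; exact: measurable_box.
move=> [y1 y2] [[/=]]; rewrite !in_itv/= => /andP[a1 a2] /andP[b1 b2] nB.
by split => //; split; rewrite /= in_itv/=; apply/andP; split; lra.
Qed.

(** The trapezoid is cut from the triangle with apex [q] and base vertices
    [base_vertex q 1 x] and [base_vertex q (-1) x] by moving a length
    [tau * |x - q|] from each half of the base to the apex. *)
Lemma exists_unit_trapezoid (B : set (plane R)) (q x : R * R) (d : R) :
  measurable B -> 0 < d -> 0 < sqnorm (displacement q x) ->
  (area (box (base_vertex q 1 x) (2 * d) `\` B) < (d ^+ 2)%:E)%E ->
  (area (box (base_vertex q (-1) x) (2 * d) `\` B) < (d ^+ 2)%:E)%E ->
  (area (box q (2 * d) `\` B) < (d ^+ 2)%:E)%E ->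
  exists a b d e : R * R, [/\ B a, B b, B d & B e] /\
    isosceles_trapezoid a b d e /\ convex_quadrilateral_area a b d e = 1%:E.
Proof.
move=> mB d0.
pose D1 := x.1 - q.1; pose D2 := x.2 - q.2; pose N := D1 ^+ 2 + D2 ^+ 2.
have -> : sqnorm (displacement q x) = N by [].
move=> N0 dense1 dense2 denseq.
(* The first bound makes the base near [q] the shorter one, the second keeps
   each vertex within [d] of the vertex of the triangle it comes from. *)
pose tau := Num.min (4 * N)^-1 (d / (`|D1| + `|D2| + 1)).
have n0 : 0 < `|D1| + `|D2| + 1 by rewrite ltr_wpDl// addr_ge0.
have tau0 : 0 < tau by rewrite lt_min invr_gt0 mulr_gt0//= divr_gt0.
have tauN : tau * 2 < N^-1.
  have : tau <= (4 * N)^-1 by rewrite ge_min lexx.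
  have : 0 < N^-1 by rewrite invr_gt0.
  rewrite invfM; lra.
have taud (y : R) : `|y| <= `|D1| + `|D2| + 1 -> `|tau * y| <= d.
  move=> yle; rewrite normrM (gtr0_norm tau0).
  apply: le_trans (_ : d / (`|D1| + `|D2| + 1) * (`|D1| + `|D2| + 1) <= _).
    by apply: ler_pM => //; [exact: ltW|rewrite ge_min lexx orbT].
  by rewrite mulfVK// gt_eqF.
have td1 : `|tau * D1| <= d by apply: taud; have := normr_ge0 D2; lra.
have td2 : `|tau * D2| <= d by apply: taud; have := normr_ge0 D1; lra.
pose z1 := (x.1 - D2 / N + tau * D2, x.2 + D1 / N - tau * D1).
pose z2 := (x.1 + D2 / N - tau * D2, x.2 - D1 / N + tau * D1).
pose z3 := (q.1 + tau * D2, q.2 - tau * D1).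
pose z4 := (q.1 - tau * D2, q.2 + tau * D1).
have e1 : (area (box z1 d `\` B) < (d ^+ 2)%:E)%E.
  apply: le_lt_trans dense1; apply: area_box_diff_subset => //.
    by rewrite /= (_ : _ - _ = tau * D2)// /D1 /D2 /N; ring.
  by rewrite /= (_ : _ - _ = - (tau * D1)) ?normrN// /D1 /D2 /N; ring.
have e2 : (area (box z2 d `\` B) < (d ^+ 2)%:E)%E.
  apply: le_lt_trans dense2; apply: area_box_diff_subset => //.
    by rewrite /= (_ : _ - _ = - (tau * D2)) ?normrN// /D1 /D2 /N; ring.
  by rewrite /= (_ : _ - _ = tau * D1)// /D1 /D2 /N; ring.
have e3 : (area (box z3 d `\` B) < (d ^+ 2)%:E)%E.
  apply: le_lt_trans denseq; apply: area_box_diff_subset => //=.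
    by rewrite addrC addKr.
  by rewrite addrC addKr normrN.
have e4 : (area (box z4 d `\` B) < (d ^+ 2)%:E)%E.
  apply: le_lt_trans denseq; apply: area_box_diff_subset => //=.
    by rewrite addrC addKr normrN.
  by rewrite addrC addKr.
have [t [B1 B2 B3 B4]] := exists_common_translate mB d0 e1 e2 e3 e4.
pose h := Num.sqrt N.
have h0 : 0 < h by rewrite sqrtr_gt0.
have hN : h ^+ 2 = N by rewrite sqr_sqrtr// ltW.
pose c := (t.1 + x.1, t.2 + x.2); pose u := (- D1 / h, - D2 / h).
have u1 : u.1 ^+ 2 + u.2 ^+ 2 = 1.
  by rewrite /u/= !expr_div_n !sqrrN -mulrDl hN divff// gt_eqF.
have hn0 : h != 0 by rewrite gt_eqF.
pose V := (N^-1 - tau) * h; pose w := tau * h.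
have w0 : 0 < w by rewrite mulr_gt0.
have wV : w < V by rewrite ltr_pM2r//; lra.
have V0 : 0 < V := lt_trans w0 wV.
have uh1 : D1 / h * h = D1 by rewrite mulfVK.
have uh2 : D2 / h * h = D2 by rewrite mulfVK.
exists (of_frame c u (0, - V)), (of_frame c u (0, V)),
  (of_frame c u (h, w)), (of_frame c u (h, - w)).
have E1 : of_frame c u (0, - V) = (t.1 + z1.1, t.2 + z1.2).
  by rewrite /of_frame /c /u /V/=; congr pair; field; rewrite hn0 gt_eqF.
have E2 : of_frame c u (0, V) = (t.1 + z2.1, t.2 + z2.2).
  by rewrite /of_frame /c /u /V/=; congr pair; field; rewrite hn0 gt_eqF.
have E3 : of_frame c u (h, w) = (t.1 + z3.1, t.2 + z3.2).
  by rewrite /of_frame /c /u /w/=; congr pair; rewrite /D1 /D2; field.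
have E4 : of_frame c u (h, - w) = (t.1 + z4.1, t.2 + z4.2).
  by rewrite /of_frame /c /u /w/=; congr pair; rewrite /D1 /D2; field.
split; first by rewrite E1 E2 E3 E4.
split; first exact: isosceles_trapezoid_frame.
rewrite trapezoid_area//; congr EFin.
rewrite /V /w -mulrDl subrK -mulrA -expr2 hN mulVf// gt_eqF//.
Qed.

End assembly.

(** * Two boxes far apart *)

Lemma dense_box_meets (R : realType) (A : set (plane R)) (q : R * R) (r : R) :
  0 < r -> (area (box q r `\` A) < (4 * r ^+ 2)%:E)%E ->
  exists2 z, box q r z & A z.
Proof.
move=> r0 lt; apply: contrapT => none.
have E : box q r `\` A = box q r.
  by apply/seteqP; split => z; [case|move=> bz; split=> // Az; apply: none; exists z].
by rewrite E area_box// ltxx in lt.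
Qed.

Lemma dense_boxU (R : realType) (A1 A2 : set (plane R)) (q : R * R) (r e : R) :
  measurable A1 -> measurable A2 ->
  (area (box q r `\` A1) < e%:E)%E -> (area (box q r `\` (A1 `|` A2)) < e%:E)%E.
Proof.
move=> m1 m2; apply: le_lt_trans; apply: le_measure; rewrite ?inE.
- by apply: measurableD; [exact: measurable_box|exact: measurableU].
- by apply: measurableD => //; exact: measurable_box.
- by move=> z [bz nz]; split => // zA; apply: nz; left.
Qed.

(** The point [z] of a small box around [q] shows that [q] is far from [p]. *)
Lemma far_apart (R : realType) (p q x z : R * R) (r d : R) : 0 < r -> d <= r ->
  `|x.1 - p.1| <= r -> `|x.2 - p.2| <= r -> box q d z ->
  ~ square (`|p.1| + `|p.2| + 2 * r + 2 + 2 / r) z ->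
  4 <= sqnorm (displacement q x) /\ 4 <= r ^+ 2 * sqnorm (displacement q x).
Proof.
move=> r0 dr xp1 xp2 [zq1 zq2] far.
(* [L] bounds from below the distance between [x] and [q]. *)
set m := _ + 2 / r in far; pose L := 2 + 2 / r.
have ir0 : 0 < 2 / r by rewrite divr_gt0.
have Lle : L ^+ 2 <= sqnorm (displacement q x).
  have coord (a b c e : R) : `|a - b| <= r -> c - d < e <= c + d ->
      `|b| <= `|p.1| + `|p.2| -> m < `|e| -> L ^+ 2 <= (a - c) ^+ 2.
    move=> ab /andP[ce1 ce2] b0 me.
    have ce : `|e - c| <= r by rewrite ler_norml; apply/andP; split; lra.
    have : `|e| <= `|e - c| + `|a - c| + `|a - b| + `|b|.
      have := ler_normD (e - c - (a - c) + (a - b)) b.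
      have -> : e - c - (a - c) + (a - b) + b = e by ring.
      have := ler_normD (e - c - (a - c)) (a - b).
      have := ler_normB (e - c) (a - c).
      lra.
    move=> tri; rewrite -[leRHS](real_normK (num_real _)) ler_sqr ?nnegrE//; last first.
      by rewrite /L addr_ge0// ltW.
    move: me; rewrite /m /L; lra.
  have [z1|z1] := leP `|z.1| m.
    have z2 : m < `|z.2|.
      rewrite ltNge; apply/negP => z2; apply: far.
      by split; rewrite /= in_itv/= -ler_norml.
    apply: le_trans (coord x.2 p.2 q.2 z.2 xp2 _ _ z2) _.
    - by move: zq2; rewrite /= in_itv.
    - by rewrite lerDr.
    - by rewrite /sqnorm/= lerDr sqr_ge0.
  apply: le_trans (coord x.1 p.1 q.1 z.1 xp1 _ _ z1) _.
  - by move: zq1; rewrite /= in_itv.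
  - by rewrite lerDl.
  - by rewrite /sqnorm/= lerDl sqr_ge0.
split.
  by apply: le_trans Lle; rewrite /L; nra.
apply: (@le_trans _ _ (r ^+ 2 * L ^+ 2)); last by rewrite ler_pM2l// exprn_gt0.
rewrite -exprMn /L mulrDr [r * (2 / r)]mulrC mulfVK ?gt_eqF//; nra.
Qed.

Theorem theorem2 (R : realType) (S : set (R * R))
  (mS : lebesgue_measurable2 S) (S_infinite : lebesgue_measure2 S = +oo%E) :
  exists a b d e : R * R,
    [/\ S a, S b, S d & S e] /\
    isosceles_trapezoid a b d e /\
    convex_quadrilateral_area a b d e = 1%:E.
Proof.
have [A1 [mA1 A1S A1_gt0 [k1 A1k]]] := far_borel_subset 0 mS S_infinite.
have inv_lt1 (n : nat) : (1 < n)%N -> 0 < (n%:R^-1 : R) < 1.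
  by move=> n1; rewrite invr_gt0 ltr0n ltnW//= invf_lt1 ?ltr1n// ltr0n ltnW.
(* [8192^-1] times the area [16 * r ^+ 2] of the box of radius [rho = 2 * r] is
   [r ^+ 2 / 512]. *)
have eps1 : 0 < (8192^-1 : R) < 1 by exact: inv_lt1.
have [p [rho [/andP[rho0 rho1] dense1]]] := exists_dense_box eps1 ltr01 mA1 A1k A1_gt0.
pose r := rho / 2.
have r0 : 0 < r by rewrite divr_gt0.
have rhoE : rho = 2 * r by rewrite /r; field.
pose m := `|p.1| + `|p.2| + 2 * r + 2 + 2 / r.
have [A2 [mA2 A2S A2_gt0 [k2 A2k]]] := far_borel_subset m mS S_infinite.
(* Likewise, [16^-1] times the area of the box of radius [del = 2 * d] is
   [d ^+ 2]. *)
have eps2 : 0 < (16^-1 : R) < 1 by exact: inv_lt1.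
have r4 : 0 < r / 4 by rewrite divr_gt0.
have [q [del [/andP[del0 del1] dense2]]] := exists_dense_box eps2 r4 mA2 A2k A2_gt0.
pose d := del / 2.
have d0 : 0 < d by rewrite divr_gt0.
have delE : del = 2 * d by rewrite /d; field.
have [z zq A2z] : exists2 z, box q del z & A2 z.
  apply: dense_box_meets => //; apply: lt_le_trans dense2 _.
  by rewrite lee_fin; have := sqr_ge0 del; clear; lra.
have far x : `|x.1 - p.1| <= r -> `|x.2 - p.2| <= r ->
    4 <= sqnorm (displacement q x) /\ 4 <= r ^+ 2 * sqnorm (displacement q x).
  move=> x1 x2; apply: (far_apart r0 _ x1 x2 zq); first by clear -delE del1 r0; lra.
  by have [] := A2S _ A2z.
have mB : measurable (A1 `|` A2) by exact: measurableU.
have dr : 8 * d <= r by clear -delE del1; lra.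
have dense1' : (area (box p (2 * r) `\` (A1 `|` A2)) < (r ^+ 2 / 512)%:E)%E.
  apply: (dense_boxU mA1 mA2); rewrite -rhoE; apply: lt_le_trans dense1 _.
  by rewrite lee_fin rhoE exprMn; clear; lra.
have [x [x1 x2 densex densex']] := exists_dense_base mB d0 dr dense1' far.
have denseq : (area (box q (2 * d) `\` (A1 `|` A2)) < (d ^+ 2)%:E)%E.
  rewrite setUC; apply: (dense_boxU mA2 mA1); rewrite -delE.
  apply: lt_le_trans dense2 _.
  by rewrite lee_fin delE exprMn; clear; lra.
have N0 : 0 < sqnorm (displacement q x).
  by have [n4 _] := far _ x1 x2; apply: lt_le_trans n4.
have [a [b [d' [e [[Ba Bb Bd Be] trap]]]]] :=
  exists_unit_trapezoid mB d0 N0 densex densex' denseq.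
have BS y : (A1 `|` A2) y -> S y by move=> [/A1S[]|/A2S[]].
by exists a, b, d', e; split => //; split; exact: BS.
Qed.
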